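(* For each of the three families of coherent configurations $\mathcal C_1$ (from tight Euclidean $t$-designs in $\mathbb R^2$), $\mathcal C_2$ (associated with the Terwilliger algebra of $H(n,2)$) and $\mathcal C_3$ (on all subspaces of $\mathbb F_q^n$), with the numbering of relations specified in their definitions, every cross-block intersection matrix $$B_1^{(i,i,j)}=\bigl(p^{(i,i,j)}_{1,\ell,\ell'}\bigr)_{\varepsilon_{i,j}\le\ell,\ell'\le r_{i,j}}$$ is tridiagonal, for all distinct fiber indices $i,j$ (with $|X_i|>1$, so that the relation $R_1^{(i,i)}$ exists).
   Context: **Conventions.** $\varepsilon_{i,j}=1-\delta_{i,j}$. Each configuration below is a coherent configuration on a finite set $X=\bigsqcup_iX_i$ with fibers $X_i$. The relations contained in $X_i\times X_j$ are $R_\ell^{(i,j)}$, $\varepsilon_{i,j}\le\ell\le r_{i,j}$, with $R_0^{(i,i)}=\{(x,x)\mid x\in X_i\}$ and $R_\ell^{(j,i)}$ the transpose of $R_\ell^{(i,j)}$. With $A_\ell^{(i,j)}$ the adjacency matrix of $R_\ell^{(i,j)}$ (as a matrix indexed by $X_i\times X_j$), the intersection numbers are defined by $$A_\ell^{(i,j)}A_m^{(j,h)}=\sum_{n=\varepsilon_{i,h}}^{r_{i,h}}p_{\ell,m,n}^{(i,j,h)}A_n^{(i,h)}.$$ A matrix $(b_{\ell,\ell'})$ is tridiagonal if $b_{\ell,\ell'}=0$ whenever $|\ell-\ell'|>1$. **$\mathcal C_1$.** Let $t,p$ be positive integers with $1\le p\le\lfloor\frac{t+5}4\rfloor$, $N=t+3-2p$,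 $0<r_1<\dots<r_p$ real, and $X_i=\{r_i(\cos\frac{(2k+i)\pi}{N},\sin\frac{(2k+i)\pi}{N})\mid 1\le k\le N\}\subset\mathbb R^2$ for $1\le i\le p$. Let $s_{i,j}$ be the number of values $\ne1$ of $\langle x,y\rangle/(r_ir_j)$ for $x\in X_i,y\in X_j$; $\xi_{i,j}=0$ if $i\equiv j\pmod2$ and $\xi_{i,j}=1$ otherwise; $r_{i,j}=s_{i,j}+1$ if $i\ne j$ and $i\equiv j\pmod2$, and $r_{i,j}=s_{i,j}$ otherwise. For $\varepsilon_{i,j}\le\ell\le r_{i,j}$, $$R_\ell^{(i,j)}=\Bigl\{(x,y)\in X_i\times X_j\Bigm| \tfrac{\langle x,y\rangle}{r_ir_j}=\cos\tfrac{(2(\ell-\varepsilon_{i,j})+\xi_{i,j})\pi}{N}\Bigr\}.$$ **$\mathcal C_2$.** Let $n$ be a positive integer and, for $0\le i\le n$, let $X_i$ be the set of $x\in\{0,1\}^n$ of Hamming weight $i$; $\operatorname{supp}(x)=\{m\mid x_m=1\}$. For $\varepsilon_{i,j}\le\ell\le r_{i,j}:=\min\{i,j,n-i,n-j\}+\varepsilon_{i,j}$, $$R_\ell^{(i,j)}=\{(x,y)\in X_i\times X_j\mid\ell=\min\{i,j\}+\varepsilon_{i,j}-|\operatorname{supp}(x)\cap\operatorname{supp}(y)|\}.$$ **$\mathcal C_3$.** Let $n$ be a positive integer, $q$ a prime power and, for $0\le i\le n$, let $X_i$ be the set of $i$-dimensional subspaces of $\mathbb F_q^n$. For $i\le j$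 and $\varepsilon_{i,j}\le\ell\le r_{i,j}:=\min\{i,n-j\}+\varepsilon_{i,j}$, $$R_\ell^{(i,j)}=\{(x,y)\in X_i\times X_j\mid\ell=i+\varepsilon_{i,j}-\dim(x\cap y)\},$$ and for $i>j$, $r_{i,j}=r_{j,i}$ and $R_\ell^{(i,j)}$ is the transpose of $R_\ell^{(j,i)}$. *)

(* Defs.v *)
From HB Require Import structures.
From mathcomp Require Import all_boot all_order all_algebra finmap.
From mathcomp Require Import reals trigo.

Set Implicit Arguments.
Unset Strict Implicit.
Unset Printing Implicit Defensive.

Import Order.TTheory GRing.Theory Num.Theory.
Local Open Scope ring_scope.

(* epsilon_{i,j} = 1 - delta_{i,j} *)
Definition eps (I : eqType) (i j : I) : nat := i != j.

(* [cc_rel i j l] represents R_l^{(i,j)}; it is a predicate on the ambient points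
   and is only meaningful on [fiber i] x [fiber j], for
   [eps i j <= l <= rank i j]. *)
Record config := Config {
  fiber_index : finType;
  point : choiceType;
  fiber : fiber_index -> {fset point};
  rank : fiber_index -> fiber_index -> nat;
  cc_rel : fiber_index -> fiber_index -> nat -> point -> point -> bool
}.

Definition in_range (C : config) (i j : fiber_index C) (l : nat) : bool :=
  (eps i j <= l <= rank i j)%N.

Definition adjmx (C : config) (i j : fiber_index C) (l : nat) :
    'M[int]_(#|{: fiber i}|, #|{: fiber j}|) :=
  \matrix_(a, b) (cc_rel i j l (val (enum_val a)) (val (enum_val b)))%:R.

(* [p i j h l m n] is p_{l,m,n}^{(i,j,h)}. *)
Definition intersection_numbers (C : config)
    (p : fiber_index C -> fiber_index C -> fiber_index C -> nat -> nat -> nat -> nat) : Prop :=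
  forall (i j h : fiber_index C) (l m : nat), in_range i j l -> in_range j h m ->
    adjmx i j l *m adjmx j h m =
    \sum_(eps i h <= n < (rank i h).+1) adjmx i h n *+ p i j h l m n.

Record coherent (C : config) : Prop := Coherent {
  fiber_neq0 : forall i : fiber_index C, fiber i != fset0;
  fiber_disjoint : forall i j : fiber_index C, i != j -> [disjoint fiber i & fiber j]%fset;
  rel_neq0 : forall (i j : fiber_index C) (l : nat), in_range i j l ->
    exists x y, [/\ x \in fiber i, y \in fiber j & cc_rel i j l x y];
  rel_partition : forall (i j : fiber_index C) (x y : point C),
    x \in fiber i -> y \in fiber j ->
    exists! l : nat, in_range i j l /\ cc_rel i j l x y;
  rel_diag : forall (i : fiber_index C) (x y : point C),
    x \in fiber i -> y \in fiber i -> cc_rel i i 0 x y = (x == y);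
  rel_transpose : forall (i j : fiber_index C) (l : nat) (x y : point C),
    in_range i j l -> x \in fiber i -> y \in fiber j ->
    cc_rel j i l y x = cc_rel i j l x y;
  rel_intersection : exists p, intersection_numbers (C := C) p
}.

Definition tridiagonal (m : nat) (b : 'M[nat]_m) : Prop :=
  forall l l' : 'I_m, (1 < `|l%:Z - l'%:Z|)%R -> b l l' = 0%N.

(* B_1^{(i,i,j)}: the row and column indices are shifted by [eps i j], so that
   they range over eps i j, ..., rank i j. *)
Definition B1 (C : config)
    (p : fiber_index C -> fiber_index C -> fiber_index C -> nat -> nat -> nat -> nat)
    (i j : fiber_index C) : 'M[nat]_((rank i j).+1 - eps i j) :=
  \matrix_(a, b) p i i j 1%N (eps i j + a)%N (eps i j + b)%N.

Definition cross_B1_tridiagonal (C : config) : Prop :=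
  forall p, intersection_numbers (C := C) p ->
  forall i j : fiber_index C, i != j -> (1 < #|` fiber i|)%N ->
  tridiagonal (B1 p i j).

Section DesignConfiguration.
Variables (R : realType) (t p : nat) (r : 'I_p -> R).

Definition C1_N : nat := (t + 3 - 2 * p)%N.

Definition dot (x y : R * R) : R := x.1 * y.1 + x.2 * y.2.

(* The fiber called X_i, 1 <= i <= p, is indexed by the ordinal i - 1. *)
Definition C1_pt (i : 'I_p) (k : nat) : R * R :=
  let theta := (2 * k + i.+1)%:R * pi / C1_N%:R in
  (r i * cos theta, r i * sin theta).

Definition C1_fiber (i : 'I_p) : {fset R * R} :=
  [fset C1_pt i k | k in iota 1 C1_N]%fset.

Definition C1_cosine (i j : 'I_p) (x y : R * R) : R := dot x y / (r i * r j).

Definition C1_s (i j : 'I_p) : nat :=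
  #|` [fset C1_cosine i j x y | x in C1_fiber i, y in C1_fiber j] `\ 1|%fset.

Definition C1_xi (i j : 'I_p) : nat := odd i != odd j.

Definition C1_rank (i j : 'I_p) : nat :=
  if (i != j) && (odd i == odd j) then (C1_s i j).+1 else C1_s i j.

Definition C1_rel (i j : 'I_p) (l : nat) (x y : R * R) : bool :=
  C1_cosine i j x y ==
  cos ((2 * (l - eps i j) + C1_xi i j)%:R * pi / C1_N%:R).

Definition C1 : config := Config C1_fiber C1_rank C1_rel.

End DesignConfiguration.

Section HammingConfiguration.
Variable n : nat.

Definition supp (x : n.-tuple bool) : {set 'I_n} := [set m | tnth x m].

Definition C2_fiber (i : 'I_n.+1) : {fset n.-tuple bool} :=
  [fset x in {: n.-tuple bool} | #|supp x| == i]%fset.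

Definition C2_rank (i j : 'I_n.+1) : nat :=
  (minn (minn i j) (minn (n - i) (n - j)) + eps i j)%N.

Definition C2_rel (i j : 'I_n.+1) (l : nat) (x y : n.-tuple bool) : bool :=
  l == (minn i j + eps i j - #|supp x :&: supp y|)%N.

Definition C2 : config := Config C2_fiber C2_rank C2_rel.

End HammingConfiguration.

Section FiniteVspace.
Import VectorInternalTheory.
Variables (F : finFieldType) (n : nat).

HB.instance Definition _ := [Countable of {vspace 'rV[F]_n} by <:].
HB.instance Definition _ := [Finite of {vspace 'rV[F]_n} by <:].

End FiniteVspace.

Section SubspaceConfiguration.
Variables (F : finFieldType) (n : nat).

Definition C3_fiber (i : 'I_n.+1) : {fset {vspace 'rV[F]_n}} :=
  [fset U in {: {vspace 'rV[F]_n}} | \dim U == i]%fset.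

Definition C3_rank (i j : 'I_n.+1) : nat :=
  if (i <= j)%N then (minn i (n - j) + eps i j)%N
  else (minn j (n - i) + eps j i)%N.

Definition C3_rel_le (i j : 'I_n.+1) (l : nat) (U W : {vspace 'rV[F]_n}) : bool :=
  l == (i + eps i j - \dim (U :&: W))%N.

Definition C3_rel (i j : 'I_n.+1) (l : nat) (U W : {vspace 'rV[F]_n}) : bool :=
  if (i <= j)%N then C3_rel_le i j l U W else C3_rel_le j i l W U.

Definition C3 : config := Config C3_fiber C3_rank C3_rel.

End SubspaceConfiguration.

(* Main.v *)
Require Import Defs.
From mathcomp Require Import all_boot all_fingroup all_order all_algebra finmap.
From mathcomp Require Import reals trigo.
From mathcomp Require Import zify ring.

(** A configuration is coherent as soon as its relations partition each block, are
    compatible with the diagonal and with transposition, and are the orbits of a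
    family of symmetries: the number of paths x -> y -> z with prescribed relations
    then depends only on the relation of (x, z)
    ([intersection_numbers_of_transitive]). Conversely a nonzero intersection number
    comes from an actual triangle, so the tridiagonality of B_1^{(i,i,j)} says that
    replacing a point of X_i by a point in relation 1 to it changes the relation to
    a fixed point of X_j by at most one step ([cross_B1_tridiagonal_of]).

    Subsets and subspaces are treated together. In both families a relation records
    the size (cardinality or dimension) of an intersection. Coordinate permutations,
    respectively linear automorphisms, act transitively on the pairs with given sizes
    and given size of the intersection ([permute_coords_transitive],
    [subspace_pair_homogeneous]), and the step property is the submodular law for
    sizes of intersections ([tridiagonal_meet_geometry]).

    For the concentric polygons the points are given by integer angles in units of
    pi / N, and two angles have the same cosine exactly when they are equal or opposite
    modulo 2 * N ([cos_angle_eq]). A relation is thus a folded angle in [0, N] of a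
    given parity; rotations and reflections are transitive on each relation
    ([C1_transitive]). Relation 1 inside a polygon is a difference of two units, and
    adding two units moves a folded angle by at most two units. *)

Set Implicit Arguments.
Unset Strict Implicit.

Import Order.TTheory GRing.Theory Num.Theory.
Local Open Scope ring_scope.

(** * Coherence and tridiagonality from symmetries and triangles *)

Definition paths2 {C : config} (i j h : fiber_index C) (l m : nat)
    (x z : point C) : {set {: fiber j}} :=
  [set y | cc_rel i j l x (val y) && cc_rel j h m (val y) z].

Lemma adjmx_mulE {C : config} (i j h : fiber_index C) (l m : nat)
    (a : 'I_#|{: fiber i}|) (b : 'I_#|{: fiber h}|) :
  (adjmx i j l *m adjmx j h m) a b =
  #|paths2 i j h l m (val (enum_val a)) (val (enum_val b))|%:R.
Proof.
rewrite mxE (reindex_onto enum_rank enum_val) /=; last first.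
  by move=> c _; rewrite enum_valK.
under eq_bigr do rewrite !mxE !enum_rankK -natrM mulnb.
rewrite -natr_sum; congr (_%:R).
rewrite (eq_bigl predT) => [|y]; last by rewrite /= enum_rankK eqxx.
by rewrite -big_mkcond sum1dep_card; apply: eq_card => y; rewrite !inE.
Qed.

(** The fibers are finite, so injectivity alone makes a symmetry permute each of
    them; this spares the construction of inverses. *)
Record symmetry (C : config) (g : point C -> point C) : Prop := Symmetry {
  symmetry_inj : injective g;
  symmetry_fiber : forall j y, y \in fiber j -> g y \in fiber j;
  symmetry_rel : forall i j l x y, x \in fiber i -> y \in fiber j ->
    cc_rel i j l (g x) (g y) = cc_rel i j l x y
}.

Definition rel_transitive (C : config) : Prop :=
  forall (i j : fiber_index C) (l : nat) (x y x' y' : point C),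
  in_range i j l -> x \in fiber i -> y \in fiber j ->
  x' \in fiber i -> y' \in fiber j ->
  cc_rel i j l x y -> cc_rel i j l x' y' ->
  exists g, [/\ @symmetry C g, g x = x' & g y = y'].

Lemma leq_card_paths2 (C : config) (g : point C -> point C)
    (i j h : fiber_index C) (l m : nat) (x z : point C) :
  @symmetry C g -> x \in fiber i -> z \in fiber h ->
  (#|paths2 i j h l m x z| <= #|paths2 i j h l m (g x) (g z)|)%N.
Proof.
move=> [ginj gfib grel] xi zh.
pose G (y : {: fiber j}) : {: fiber j} := [` gfib j (val y) (valP y)]%fset.
have Ginj : injective G.
  by move=> y y' /(congr1 val) /= /ginj /val_inj.
rewrite -(card_imset _ Ginj); apply/subset_leq_card/subsetP => _ /imsetP[y + ->].
by rewrite !inE /= !grel // (valP y).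
Qed.

(** A symmetry injects the paths over one pair into the paths over its image.
    Transitivity provides symmetries in both directions, hence equality. *)
Lemma eq_card_paths2 (C : config) (i j h : fiber_index C) (l m n : nat)
    (x z x' z' : point C) :
  rel_transitive C -> in_range i h n ->
  x \in fiber i -> z \in fiber h -> x' \in fiber i -> z' \in fiber h ->
  cc_rel i h n x z -> cc_rel i h n x' z' ->
  #|paths2 i j h l m x z| = #|paths2 i j h l m x' z'|.
Proof.
move=> trans n_range xi zh x'i z'h r r'; apply/eqP; rewrite eqn_leq.
have [g [gS gx gz]] := trans _ _ _ _ _ _ _ n_range xi zh x'i z'h r r'.
have [g' [g'S gx' gz']] := trans _ _ _ _ _ _ _ n_range x'i z'h xi zh r' r.
apply/andP; split.
  by rewrite -gx -gz; apply: leq_card_paths2.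
by rewrite -gx' -gz'; apply: leq_card_paths2.
Qed.

Definition rel_partitioned (C : config) : Prop :=
  forall (i j : fiber_index C) (x y : point C),
  x \in fiber i -> y \in fiber j ->
  exists! l : nat, in_range i j l /\ cc_rel i j l x y.

(** The adjacency matrices of one block have disjoint supports, so a linear
    combination of them has at each entry a single coefficient. Both the existence
    of intersection numbers and their combinatorial meaning rest on this. *)
Lemma sum_adjmxE (C : config) (i j : fiber_index C) (l : nat) (f : nat -> nat)
    (a : 'I_#|{: fiber i}|) (b : 'I_#|{: fiber j}|) :
  rel_partitioned C -> in_range i j l ->
  cc_rel i j l (val (enum_val a)) (val (enum_val b)) ->
  (\sum_(eps i j <= n < (rank i j).+1) adjmx i j n *+ f n) a b = (f l)%:R.
Proof.
move=> part l_range l_rel; rewrite summxE.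
have [l0 [_ l0_uniq]] := part _ _ _ _ (valP (enum_val a)) (valP (enum_val b)).
rewrite (bigD1_seq l) /=; last exact: iota_uniq.
  rewrite mulmxnE mxE l_rel big1_seq ?addr0 // => n.
  rewrite mem_index_iota ltnS => /andP[n_neq n_range]; rewrite mulmxnE mxE.
  case: (boolP (cc_rel _ _ _ _ _)) => [n_rel|_]; last by rewrite mul0rn.
  by rewrite -(l0_uniq n) // -(l0_uniq l) // eqxx in n_neq.
by rewrite mem_index_iota ltnS.
Qed.

(** By transitivity the number of paths over a pair depends only on the relation
    that contains it, so any representative pair can be used to define it. *)
Lemma intersection_numbers_of_transitive (C : config) :
  rel_partitioned C -> rel_transitive C ->
  exists p, intersection_numbers (C := C) p.
Proof.
move=> part trans.
pose p (i j h : fiber_index C) l m n : nat := #|if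
  [pick xz : {: fiber i} * {: fiber h} | cc_rel i h n (val xz.1) (val xz.2)]
  is Some xz then paths2 i j h l m (val xz.1) (val xz.2) else set0|.
(* The value [set0] is taken only for empty relations, which no entry sees. *)
exists p => i j h l m _ _; apply/matrixP => a b.
have [n [[n_range n_rel] _]] := part _ _ _ _ (valP (enum_val a)) (valP (enum_val b)).
rewrite (sum_adjmxE _ part n_range n_rel) adjmx_mulE; congr (_%:R).
rewrite /p; case: pickP => [[x' z'] /= rel'|/(_ (enum_val a, enum_val b))]; last first.
  by rewrite /= n_rel.
exact: (eq_card_paths2 _ _ _ trans n_range (valP (enum_val a)) (valP (enum_val b))
  (valP x') (valP z')).
Qed.

Lemma intersection_number_neq0 (C : config) p (i j h : fiber_index C)
    (l m n : nat) :
  coherent C -> intersection_numbers (C := C) p ->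
  in_range i j l -> in_range j h m -> in_range i h n -> p i j h l m n != 0%N ->
  exists x y z, [/\ [/\ x \in fiber i, y \in fiber j & z \in fiber h],
    cc_rel i j l x y, cc_rel j h m y z & cc_rel i h n x z].
Proof.
move=> cohC pC l_range m_range n_range p_neq0.
have [x [z [xi zh r]]] := rel_neq0 cohC n_range.
have := pC _ _ _ _ _ l_range m_range.
move/matrixP/(_ (enum_rank [` xi]%fset) (enum_rank [` zh]%fset)).
rewrite (sum_adjmxE _ (rel_partition cohC) n_range) ?enum_rankK // adjmx_mulE.
rewrite !enum_rankK /= => /eqP; rewrite eqr_nat => /eqP card_p.
have /card_gt0P[y] : (0 < #|paths2 i j h l m x z|)%N by rewrite card_p lt0n.
rewrite inE => /andP[rxy ryz]; exists x, (val y), z; split=> //.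
by split=> //; apply: valP.
Qed.

(** A nonzero entry in row [l] and column [l'] comes from a triangle whose side in
    [fiber i] has relation 1. As that relation is symmetric, exchanging the two
    points of [fiber i] exchanges [l] and [l'], so a one-sided bound suffices. *)
Lemma cross_B1_tridiagonal_of (C : config) :
  coherent C ->
  (forall (i j : fiber_index C) (l l' : nat) (x y z : point C),
    i != j -> x \in fiber i -> y \in fiber i -> z \in fiber j ->
    in_range i j l -> in_range i j l' ->
    cc_rel i i 1 x y -> cc_rel i j l y z -> cc_rel i j l' x z ->
    (l' <= l.+1)%N) ->
  cross_B1_tridiagonal C.
Proof.
move=> cohC step p pC i j neq_ij card_i a b ab_far.
have in_range_shift (c : 'I_((rank i j).+1 - eps i j)) : in_range i j (eps i j + c).
  by case: c => c c_lt; rewrite /in_range /=; lia.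
have range1 : in_range i i 1%N.
  have [x [y [xi yi neq_xy]]] : exists x y,
      [/\ x \in fiber i, y \in fiber i & x != y].
    case/fset0Pn: (fiber_neq0 cohC i) => x xi.
    have : (0 < #|` fiber i `\ x|%fset)%N by rewrite (cardfsD1 x) xi in card_i.
    rewrite cardfs_gt0 => /fset0Pn[y]; rewrite !inE => /andP[neq_yx yi].
    by exists x, y; rewrite eq_sym.
  have [l [[l_range rl] _]] := rel_partition cohC xi yi.
  move: l_range; rewrite /in_range /eps eqxx /=.
  case: l rl => [|l] rl /(leq_trans _) -> //.
  by rewrite (rel_diag cohC) // (negPf neq_xy) in rl.
rewrite mxE; apply/eqP/negPn/negP => p_neq0.
have [x [y [z [[xi yi zj] rxy ryz rxz]]]] := intersection_number_neq0 cohC pC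
  range1 (in_range_shift a) (in_range_shift b) p_neq0.
have ryx : cc_rel i i 1 y x by rewrite (rel_transpose cohC).
have := step _ _ _ _ _ _ _ neq_ij xi yi zj
  (in_range_shift a) (in_range_shift b) rxy ryz rxz.
have := step _ _ _ _ _ _ _ neq_ij yi xi zj
  (in_range_shift b) (in_range_shift a) ryx rxz ryz.
lia.
Qed.

(** * Configurations given by sizes of intersections *)

(** The common features of subsets and of subspaces: [meet x y] stands for the size
    (cardinality or dimension) of the intersection, so that [meet x x] is the size
    of [x]. Points of every size are available in an ambient object of size [n], and
    the last two fields say that a pair of points is possible as soon as its
    three numbers pass the obvious inequalities, and that these numbers determine
    it up to a map preserving [meet]. *)
Record meet_geometry (n : nat) (C : config) (level : fiber_index C -> nat)
    (meet : point C -> point C -> nat) : Prop := MeetGeometry {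
  level_inj : injective level;
  level_le : forall i, (level i <= n)%N;
  mem_fiberE : forall i x, (x \in fiber i) = (meet x x == level i);
  rankE : forall i j, rank i j =
    (minn (minn (level i) (level j)) (minn (n - level i) (n - level j)) + eps i j)%N;
  relE : forall i j l x y, cc_rel i j l x y =
    (l == minn (level i) (level j) + eps i j - meet x y)%N;
  meet_sym : forall x y, meet x y = meet y x;
  meet_le : forall x y, (meet x y <= meet x x)%N;
  meet_eq : forall x y, meet x y = meet x x -> meet x y = meet y y -> x = y;
  meet_cover : forall x y, (meet x x + meet y y <= n + meet x y)%N;
  meet_submodular : forall x y z, (meet x y + meet y z <= meet y y + meet x z)%N;
  meet_realize : forall i j m : nat, (i <= n)%N -> (j <= n)%N ->
    (m <= i)%N -> (m <= j)%N -> (i + j <= n + m)%N ->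
    exists x y, [/\ meet x x = i, meet y y = j & meet x y = m];
  meet_homogeneous : forall x y x' y', meet x x = meet x' x' ->
    meet y y = meet y' y' -> meet x y = meet x' y' ->
    exists g : point C -> point C, [/\ injective g,
      forall u v, meet (g u) (g v) = meet u v, g x = x' & g y = y']
}.

Lemma coherent_meet_geometry (n : nat) (C : config) level meet :
  @meet_geometry n C level meet -> coherent C.
Proof.
move=> [inj_level le_level fiberE rkE rE mtC mt_le mt_eq mt_cover _ realize homog].
have mt_le' x y : (meet x y <= meet y y)%N by rewrite mtC.
have partitioned : rel_partitioned C.
  move=> i j x y; rewrite !fiberE => /eqP xi /eqP yj.
  exists (minn (level i) (level j) + eps i j - meet x y)%N.
  split=> [|l []]; last by rewrite rE => _ /eqP.
  split; last by rewrite rE.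
  have := mt_le x y; have := mt_le' x y; have := mt_cover x y.
  rewrite /in_range rkE xi yj; lia.
split=> //.
- move=> i; have [x [_ [xi _ _]]] := realize (level i) 0%N 0%N (le_level i) isT isT isT
    ltac:(by rewrite !addn0).
  by apply/fset0Pn; exists x; rewrite fiberE xi.
- move=> i j neq_ij; apply/fdisjointP => x; rewrite !fiberE => /eqP->.
  by apply: contra neq_ij => /eqP/inj_level->.
- move=> i j l; rewrite /in_range rkE => l_range.
  have := le_level i; have := le_level j => le_jn le_in.
  have [|||x [y [xi yj xy]]] :=
    realize (level i) (level j) (minn (level i) (level j) + eps i j - l)%N le_in le_jn.
  - lia.
  - lia.
  - lia.
  by exists x, y; rewrite !fiberE rE xi yj xy; split=> //; lia.
- move=> i x y; rewrite !fiberE rE /eps eqxx minnn addn0 => /eqP xi /eqP yi.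
  apply/eqP/eqP => [eq0|->]; last by rewrite yi subnn.
  by apply: mt_eq; have := mt_le x y; lia.
- by move=> i j l x y _ _ _; rewrite !rE minnC mtC /eps [j == i]eq_sym.
apply: intersection_numbers_of_transitive => // i j l x y x' y' _.
rewrite !fiberE !rE => /eqP xi /eqP yj /eqP x'i /eqP y'j /eqP l_xy /eqP l_x'y'.
have [|||g [g_inj g_meet gx gy]] := homog x y x' y'; rewrite ?xi ?yj //.
  have := mt_le x y; have := mt_le' x y; have := mt_le x' y'; have := mt_le' x' y'.
  lia.
exists g; split=> //; split=> // [k u|k h m u v _ _].
  by rewrite !fiberE g_meet.
by rewrite !rE g_meet.
Qed.

(** If [x] and [y] have the same size and are in relation 1, their intersection has
    one element (or dimension) less, and the submodular law
    |x /\ y| + |y /\ z| <= |y| + |x /\ z| gives |y /\ z| <= |x /\ z| + 1. *)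
Lemma tridiagonal_meet_geometry (n : nat) (C : config) level meet :
  @meet_geometry n C level meet -> cross_B1_tridiagonal C.
Proof.
move=> G; apply: cross_B1_tridiagonal_of; first exact: coherent_meet_geometry G.
case: G => _ _ fiberE _ rE mtC mt_le _ _ submod _ _ i j l l' x y z _.
rewrite !fiberE !rE => /eqP xi /eqP yi /eqP zj _ _ /eqP xy /eqP-> /eqP->.
have := submod x y z; have := mt_le x y; rewrite yi xi.
by move: xy; rewrite /eps eqxx; lia.
Qed.

(** * Subsets of a finite set *)

Lemma in_C2_fiber (n : nat) (i : 'I_n.+1) (x : n.-tuple bool) :
  (x \in C2_fiber i) = (#|supp x| == i).
Proof. by rewrite in_fset inE. Qed.

Lemma card_ord_interval (n a b : nat) :
  (b <= n)%N -> #|[set k : 'I_n | (a <= k < b)%N]| = (b - a)%N.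
Proof.
move=> le_bn; rewrite -sum1dep_card -(big_mkord (fun k => a <= k < b)%N (fun _ => 1%N)).
rewrite -(big_nat_widen _ _ _ (fun k => a <= k)%N) // -(big_nat_widenl _ _ _ predT) //.
by rewrite sum_nat_const_nat muln1.
Qed.

Definition tuple_of_set (n : nat) (A : {set 'I_n}) : n.-tuple bool :=
  [tuple k \in A | k < n].

Lemma supp_tuple_of_set (n : nat) (A : {set 'I_n}) : supp (tuple_of_set A) = A.
Proof. by apply/setP => k; rewrite inE tnth_mktuple. Qed.

Lemma supp_inj (n : nat) : injective (@supp n).
Proof.
by move=> x y /setP eq_xy; apply: eq_from_tnth => k; have := eq_xy k; rewrite !inE.
Qed.

Definition permute_coords (n : nat) (s : {perm 'I_n}) (x : n.-tuple bool) :
  n.-tuple bool := [tuple tnth x (s k) | k < n].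

Lemma supp_permute_coords (n : nat) (s : {perm 'I_n}) (x : n.-tuple bool) :
  supp (permute_coords s x) = s @^-1: supp x.
Proof. by apply/setP => k; rewrite !inE tnth_mktuple. Qed.

Lemma card_preim_perm (n : nat) (s : {perm 'I_n}) (A : {set 'I_n}) :
  #|s @^-1: A| = #|A|.
Proof. by rewrite -im_permV card_imset //; apply: perm_inj. Qed.

Lemma permute_coords_inj (n : nat) (s : {perm 'I_n}) : injective (permute_coords s).
Proof.
move=> x y eq_xy; apply: eq_from_tnth => k.
have /(congr1 (fun u : n.-tuple bool => tnth u (s^-1%g k))) := eq_xy.
by rewrite !tnth_mktuple permKV.
Qed.

(** A pair of words is a word over the alphabet of pairs of bits, and two words are
    rearrangements of each other as soon as each letter occurs equally often in
    both. The numbers of occurrences of the four letters follow from the two weights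
    and the size of the intersection. *)
Lemma permute_coords_transitive (n : nat) (x y x' y' : n.-tuple bool) :
  #|supp x| = #|supp x'| -> #|supp y| = #|supp y'| ->
  #|supp x :&: supp y| = #|supp x' :&: supp y'| ->
  exists s : {perm 'I_n}, permute_coords s x = x' /\ permute_coords s y = y'.
Proof.
move=> eq_x eq_y eq_xy.
pose pairs (u v : n.-tuple bool) := [tuple (tnth u k, tnth v k) | k < n].
have count_pairs u v a : count_mem a (pairs u v) =
    #|[set k | (tnth u k == a.1) && (tnth v k == a.2)]|.
  rewrite count_map -size_filter cardE /enum_mem -enumT /=; congr size.
  by rewrite enumT; apply: eq_filter => k; rewrite !inE -pair_eqE /=.
have perm_pairs : perm_eq (pairs x' y') (pairs x y).
  apply/allP => /= -[b c] _ /=; rewrite !count_pairs /=.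
  suff count_cells (u v : n.-tuple bool) : [/\
      #|[set k | (tnth u k == true) && (tnth v k == true)]| = #|supp u :&: supp v|,
      #|[set k | (tnth u k == true) && (tnth v k == false)]| = (#|supp u| - #|supp u :&: supp v|)%N,
      #|[set k | (tnth u k == false) && (tnth v k == true)]| = (#|supp v| - #|supp u :&: supp v|)%N &
      #|[set k | (tnth u k == false) && (tnth v k == false)]| =
        (n - (#|supp u| + #|supp v| - #|supp u :&: supp v|))%N].
    have [xy1 xy2 xy3 xy4] := count_cells x y.
    have [xy'1 xy'2 xy'3 xy'4] := count_cells x' y'.
    by case: b; case: c; rewrite ?(xy1, xy2, xy3, xy4, xy'1, xy'2, xy'3, xy'4) ?eq_x ?eq_y ?eq_xy.
  split.
  - by apply: eq_card => k; rewrite !inE !eqb_id.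
  - by rewrite -cardsD; apply: eq_card => k; rewrite !inE eqb_id eqbF_neg andbC.
  - rewrite setIC -cardsD; apply: eq_card => k.
    by rewrite !inE eqb_id eqbF_neg.
  - rewrite -cardsU [LHS]cardsCs card_ord; congr (n - _)%N.
    by apply: eq_card => k; rewrite !inE !eqbF_neg negb_and !negbK.
have /tuple_permP[s eq_s] := perm_pairs; exists s.
have eq_k k : (tnth x' k, tnth y' k) = (tnth x (s k), tnth y (s k)).
  have /(congr1 (fun u : n.-tuple _ => tnth u k)) : pairs x' y' = [tuple tnth (pairs x y) (s i) | i < n].
    exact/val_inj.
  by rewrite !tnth_mktuple.
by split; apply: eq_from_tnth => k; rewrite tnth_mktuple; case: (eq_k k).
Qed.

Lemma meet_geometry_C2 (n : nat) :
  @meet_geometry n (C2 n) (@nat_of_ord n.+1)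
    (fun x y : n.-tuple bool => #|supp x :&: supp y|).
Proof.
split=> //=.
- exact: val_inj.
- by move=> i; rewrite -ltnS.
- by move=> i x; rewrite in_C2_fiber setIid.
- by move=> x y; rewrite setIC.
- by move=> x y; rewrite setIid subset_leq_card // subsetIl.
- move=> x y; rewrite !setIid => eq_x eq_y; apply: supp_inj.
  have sub_xy : supp x \subset supp y.
    by apply/setIidPl/eqP; rewrite eqEcard subsetIl eq_x /=.
  by apply/eqP; rewrite eqEcard sub_xy -eq_x eq_y leqnn.
- move=> x y; rewrite !setIid -cardsUI leq_add2r.
  by rewrite -[X in (_ <= X)%N]card_ord max_card.
- move=> x y z; rewrite setIid.
  rewrite -cardsUI leq_add // subset_leq_card //.
    by rewrite subUset subsetIl subsetIr.
  by apply/subsetP => k; rewrite !inE; case: (tnth x k); case: (tnth y k).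
- move=> i j m le_in le_jn le_mi le_mj le_ij.
  (* Two segments of coordinates that overlap in [m] places. *)
  pose A := [set k : 'I_n | (0 <= k < i)%N].
  pose B := [set k : 'I_n | (i - m <= k < i - m + j)%N].
  exists (tuple_of_set A), (tuple_of_set B); rewrite !supp_tuple_of_set !setIid.
  have -> : A :&: B = [set k : 'I_n | (i - m <= k < i)%N].
    by apply/setP => k; rewrite !inE; lia.
  by rewrite !card_ord_interval; [split|..]; lia.
- move=> x y x' y'; rewrite !setIid => eq_x eq_y eq_xy.
  have [s [sx sy]] := permute_coords_transitive eq_x eq_y eq_xy.
  exists (permute_coords s); split=> // [|u v]; first exact: permute_coords_inj.
  by rewrite !supp_permute_coords -preimsetI card_preim_perm.
Qed.

(** * Subspaces of a finite vector space *)

(** Extending a basis [A] of the intersection to both subspaces gives [B] and [C];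
    the union of the three is a basis of the sum, completed by [D]. All four sizes
    depend only on the dimensions of the two subspaces and of their intersection. *)
Lemma adapted_basis (K : fieldType) (vT : vectType K) (U W : {vspace vT}) :
  exists A B C D : seq vT,
  [/\ basis_of {:vT} (A ++ B ++ C ++ D), <<A ++ B>>%VS = U, <<A ++ C>>%VS = W &
      [/\ size A = \dim (U :&: W), size B = (\dim U - \dim (U :&: W))%N,
          size C = (\dim W - \dim (U :&: W))%N &
          size D = (\dim {:vT} - (\dim U + \dim W - \dim (U :&: W)))%N]].
Proof.
exists (vbasis (U :&: W)), (vbasis (U :\: W)), (vbasis (W :\: U)), (vbasis (U + W)^C).
have span_vb (V : {vspace vT}) : (<<vbasis V>> = V)%VS by apply/span_basis/vbasisP.
have eqU : (U :&: W + (U :\: W) = U)%VS by rewrite addvC addv_diff_cap.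
have eqW : (U :&: W + (W :\: U) = W)%VS by rewrite addvC [(U :&: W)%VS]capvC addv_diff_cap.
have dimU := dimv_cap_compl U W.
have dimW : (\dim (U :&: W) + \dim (W :\: U))%N = \dim W.
  by rewrite [(U :&: W)%VS]capvC dimv_cap_compl.
have dimUW := dimv_sum_cap U W.
have le_full : (\dim (U + W) <= \dim {:vT})%N by rewrite dimvS ?subvf.
have dimC := dimv_compl (U + W).
rewrite !span_cat !span_vb eqU eqW !size_tuple; split=> //; last by split; lia.
rewrite basisEdim !size_cat !size_tuple !span_cat !span_vb; apply/andP; split.
  rewrite -(addv_complf (U + W)) !addvA eqU addvS // subv_add addvSl /=.
  by rewrite -{1}eqW addvS // -{2}eqU addvSl.
lia.
Qed.

(** The automorphism sends a basis adapted to the first pair to a basis adapted to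
    the second one, block by block. *)
Lemma subspace_pair_homogeneous (K : fieldType) (vT : vectType K)
    (U W U' W' : {vspace vT}) :
  \dim U = \dim U' -> \dim W = \dim W' -> \dim (U :&: W) = \dim (U' :&: W') ->
  exists f : 'End(vT), [/\ lker f == 0%VS, (f @: U)%VS = U' & (f @: W)%VS = W'].
Proof.
move=> eqU eqW eqI.
have [A [B [C [D [basX defU defW [szA szB szC szD]]]]]] := adapted_basis U W.
have [A' [B' [C' [D' [basX' defU' defW' [szA' szB' szC' szD']]]]]] := adapted_basis U' W'.
have [f] := linear_of_free (A ++ B ++ C ++ D) (A' ++ B' ++ C' ++ D').
move=> /(_ (basis_free basX)); rewrite !size_cat szA szB szC szD.
rewrite szA' szB' szC' szD' eqU eqW eqI => /(_ erefl) f_map.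
have {}f_map : map (linfun f) (A ++ B ++ C ++ D) = A' ++ B' ++ C' ++ D'.
  by rewrite -f_map; apply: eq_map => v; rewrite lfunE.
have full : limg (linfun f) = fullv.
  by rewrite -{1}(span_basis basX) limg_span f_map; apply: span_basis basX'.
move: f_map; rewrite !map_cat => /eqP.
rewrite eqseq_cat ?size_map ?szA ?szA' // => /andP[/eqP fA].
rewrite eqseq_cat ?size_map ?szB ?szB' ?eqU ?eqI // => /andP[/eqP fB].
rewrite eqseq_cat ?size_map ?szC ?szC' ?eqW ?eqI // => /andP[/eqP fC _].
exists (linfun f); split.
- rewrite -dimv_eq0; have := limg_ker_dim (linfun f) fullv.
  rewrite full capfv; lia.
- by rewrite -defU limg_span map_cat fA fB.
- by rewrite -defW limg_span map_cat fA fC.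
Qed.

Lemma in_C3_fiber (F : finFieldType) (n : nat) (i : 'I_n.+1) (U : {vspace 'rV[F]_n}) :
  (U \in C3_fiber F i) = (\dim U == i).
Proof. by rewrite in_fset inE. Qed.

Lemma meet_geometry_C3 (F : finFieldType) (n : nat) :
  @meet_geometry n (C3 F n) (@nat_of_ord n.+1)
    (fun U W : {vspace 'rV[F]_n} => \dim (U :&: W)).
Proof.
have dim_full : \dim {: 'rV[F]_n} = n by rewrite dimvf dim_matrix; apply: mul1n.
split=> //=.
- exact: val_inj.
- by move=> i; rewrite -ltnS.
- by move=> i x; rewrite in_C3_fiber capvv.
- move=> i j; rewrite /C3_rank /eps [j == i]eq_sym.
  have le_in := ltn_ord i; have le_jn := ltn_ord j.
  by case: ifP => le_ij; congr (_ + _)%N; lia.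
- move=> i j l U W; rewrite /C3_rel /C3_rel_le /eps [j == i]eq_sym.
  by case: leqP => _ //; rewrite capvC.
- by move=> U W; rewrite capvC.
- by move=> U W; rewrite capvv dimvS // capvSl.
- move=> U W; rewrite !capvv => eq_U eq_W.
  have /eqP eq1 : (U :&: W)%VS == U by rewrite eqEdim capvSl eq_U /=.
  have /eqP eq2 : (U :&: W)%VS == W by rewrite eqEdim capvSr eq_W /=.
  by rewrite -eq1 eq2.
- move=> U W; rewrite !capvv -dimv_sum_cap leq_add2r.
  by rewrite -[X in (_ <= X)%N]dim_full dimvS // subvf.
- move=> U V W; rewrite capvv -dimv_sum_cap leq_add // dimvS //.
    by rewrite subv_add capvSr capvSl.
  rewrite subv_cap (subv_trans (capvSl _ _) (capvSl _ _)).
  by rewrite (subv_trans (capvSr _ _) (capvSr _ _)).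
- move=> i j m le_in le_jn le_mi le_mj le_ij.
  (* Two consecutive ranges of a basis that overlap in [m] vectors. *)
  pose X := vbasis {: 'rV[F]_n}.
  pose A := take (i - m) X.
  pose B := take m (drop (i - m) X).
  pose C := take (j - m) (drop m (drop (i - m) X)).
  pose D := drop (j - m) (drop m (drop (i - m) X)).
  have freeX : free (A ++ B ++ C ++ D).
    by rewrite !cat_take_drop; apply: basis_free (vbasisP _).
  have szX : size X = n by rewrite size_tuple.
  have [szA szB szC] : [/\ size A = (i - m)%N, size B = m & size C = (j - m)%N].
    by rewrite !size_takel ?size_drop ?szX //; lia.
  have dim_free Y : free Y -> \dim <<Y>> = size Y by move/eqnP.
  have dimAB : \dim <<A ++ B>> = i.
    have /dim_free-> : free (A ++ B) by move: freeX; rewrite catA; apply: catl_free.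
    by rewrite size_cat szA szB; lia.
  have dimBC : \dim <<B ++ C>> = j.
    have /dim_free-> : free (B ++ C).
      by move: freeX => /catr_free; rewrite catA; apply: catl_free.
    by rewrite size_cat szB szC; lia.
  have dimABC : \dim <<A ++ B ++ C>> = (i + j - m)%N.
    have /dim_free-> : free (A ++ B ++ C).
      by move: freeX; rewrite !catA; apply: catl_free.
    by rewrite !size_cat szA szB szC; lia.
  exists <<A ++ B>>%VS, <<B ++ C>>%VS; rewrite !capvv; split=> //.
  have := dimv_sum_cap <<A ++ B>> <<B ++ C>>.
  have -> : (<<A ++ B>> + <<B ++ C>> = <<A ++ B ++ C>>)%VS.
    by rewrite !span_cat -addvA [(<<B>> + _)%VS in LHS]addvA addvv.
  rewrite dimAB dimBC dimABC; lia.
- move=> U W U' W'; rewrite !capvv => eqU eqW eqI.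
  have [f [kf fU fW]] := subspace_pair_homogeneous eqU eqW eqI.
  exists (fun V => f @: V)%VS; split=> // [V V' /eqP|V V'].
    by rewrite eqEsubv !limg_ker0 // -eqEsubv => /eqP.
  by rewrite -lker0_img_cap // limg_dim_eq // (eqP kf) capv0.
Qed.

(** * Angles that are multiples of pi / N *)

(** On a polygon, angles are integers modulo [2 * N], in units of pi / N. *)
Definition angle (R : realType) (N : nat) (u : int) : R := u%:~R * pi / N%:R.

Lemma periodicz (U V : zmodType) (f : U -> V) (T : U) (z : int) (a : U) :
  periodic f T -> f (a + T *~ z) = f a.
Proof.
move=> fT; case: z => n; first exact: periodicn.
by rewrite NegzE mulrNz -[LHS](periodicn fT n.+1) subrK.
Qed.

Lemma angle_turn (R : realType) (N : nat) (u z : int) : (0 < N)%N ->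
  angle R N (u + 2 * N%:Z * z) = angle R N u + (pi *+ 2) *~ z.
Proof.
move=> N_gt0; have : N%:R != 0 :> R by rewrite pnatr_eq0 -lt0n.
rewrite /angle !rmorphD /= !rmorphM /= -pmulrn -[(pi *+ 2) *~ z]mulrzr => N_neq0.
by field.
Qed.

Lemma cos_angle_turn (R : realType) (N : nat) (u z : int) : (0 < N)%N ->
  cos (angle R N (u + 2 * N%:Z * z)) = cos (angle R N u).
Proof. by move=> N_gt0; rewrite angle_turn // periodicz //; apply: cosD2pi. Qed.

Lemma sin_angle_turn (R : realType) (N : nat) (u z : int) : (0 < N)%N ->
  sin (angle R N (u + 2 * N%:Z * z)) = sin (angle R N u).
Proof. by move=> N_gt0; rewrite angle_turn // periodicz //; apply: sinD2pi. Qed.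

Lemma angleD (R : realType) (N : nat) (u v : int) :
  angle R N (u + v) = angle R N u + angle R N v.
Proof. by rewrite /angle rmorphD /= !mulrDl. Qed.

Lemma angleN (R : realType) (N : nat) (u : int) : angle R N (- u) = - angle R N u.
Proof. by rewrite /angle rmorphN /= !mulNr. Qed.

Lemma cos_angle_inj (R : realType) (N d d' : nat) : (0 < N)%N ->
  (d <= N)%N -> (d' <= N)%N ->
  cos (angle R N d) = cos (angle R N d') -> d = d'.
Proof.
move=> N_gt0 le_d le_d'.
have N_gt0R : 0 < N%:R :> R by rewrite ltr0n.
have angle_itv (e : nat) : (e <= N)%N -> angle R N e \in `[0, pi].
  move=> le_e; rewrite in_itv /= /angle -pmulrn.
  rewrite divr_ge0 ?mulr_ge0 ?pi_ge0 ?ler0n //=.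
  by rewrite ler_pdivrMr // mulrC ler_wpM2l ?pi_ge0 // ler_nat.
move/cos_inj => /(_ (angle_itv _ le_d) (angle_itv _ le_d')).
rewrite /angle -!pmulrn => /(divIf (lt0r_neq0 N_gt0R)).
by move/(mulIf (lt0r_neq0 (pi_gt0 R)))/eqP; rewrite eqr_nat => /eqP.
Qed.

Lemma fold_angle (N : nat) (u : int) : (0 < N)%N ->
  exists (d : nat) (z : int), (d <= N)%N /\
    (u = d%:Z + 2 * N%:Z * z \/ u = - d%:Z + 2 * N%:Z * z).
Proof.
move=> N_gt0; pose r := (u %% (2 * N%:Z))%Z.
have r_ge0 : 0 <= r by apply: modz_ge0; lia.
have r_lt : r < 2 * N%:Z by apply: ltz_pmod; lia.
have u_eq := divz_eq u (2 * N%:Z); rewrite -/r in u_eq.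
set q := (u %/ (2 * N%:Z))%Z in u_eq.
have [le_rN|lt_Nr] := leP r N%:Z.
  by exists (absz r), q; split; [lia|left; rewrite gez0_abs // {1}u_eq mulrC addrC].
exists (absz (2 * N%:Z - r)%R), (q + 1); split; first lia.
right; rewrite gez0_abs; last lia.
by rewrite {1}u_eq; ring.
Qed.

(** Both angles fold to a representative in [0, N], where the cosine is injective;
    this turns every question about cosines into a congruence. *)
Lemma cos_angle_eq (R : realType) (N : nat) (u v : int) : (0 < N)%N ->
  cos (angle R N u) = cos (angle R N v) ->
  exists z : int, u = v + 2 * N%:Z * z \/ u = - v + 2 * N%:Z * z.
Proof.
move=> N_gt0.
have fold (w : int) : exists (d : nat) (z : int), [/\ (d <= N)%N,
    w = d%:Z + 2 * N%:Z * z \/ w = - d%:Z + 2 * N%:Z * z &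
    cos (angle R N w) = cos (angle R N d)].
  have [d [z [le_d [->|->]]]] := fold_angle w N_gt0.
    by exists d, z; rewrite cos_angle_turn //; split=> //; left.
  by exists d, z; rewrite cos_angle_turn // angleN cosN; split=> //; right.
have [d [z [le_d u_eq ->]]] := fold u.
have [d' [z' [le_d' v_eq ->]]] := fold v.
move/(cos_angle_inj N_gt0 le_d le_d') => eq_d; rewrite -{d' le_d'}eq_d in v_eq.
case: u_eq v_eq => -> [->|->]; [exists (z - z')|exists (z + z')|exists (z + z')|exists (z - z')];
  by [left; ring|right; ring].
Qed.

(** * Concentric regular polygons *)

Definition polar (R : realType) (N : nat) (rho : R) (u : int) : R * R :=
  (rho * cos (angle R N u), rho * sin (angle R N u)).

Lemma polar_turn (R : realType) (N : nat) (rho : R) (u z : int) : (0 < N)%N ->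
  polar N rho (u + 2 * N%:Z * z) = polar N rho u.
Proof. by move=> N_gt0; rewrite /polar cos_angle_turn // sin_angle_turn. Qed.

Lemma dot_polar (R : realType) (N : nat) (rho rho' : R) (u v : int) :
  dot (polar N rho u) (polar N rho' v) = rho * rho' * cos (angle R N (u - v)).
Proof. by rewrite /dot /= angleD angleN cosB; ring. Qed.

Lemma dotC (R : realType) (x y : R * R) : dot x y = dot y x.
Proof. by rewrite /dot mulrC [x.2 * _]mulrC. Qed.

Lemma dot_eq (R : realType) (x y : R * R) :
  dot x x = dot x y -> dot y y = dot x y -> x = y.
Proof.
case: x y => [x1 x2] [y1 y2]; rewrite /dot /= => eq_x eq_y.
have : (x1 - y1) ^+ 2 + (x2 - y2) ^+ 2 = 0.
  transitivity ((x1 * x1 + x2 * x2) - (x1 * y1 + x2 * y2)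
    + ((y1 * y1 + y2 * y2) - (x1 * y1 + x2 * y2))); first ring.
  by rewrite eq_x eq_y !subrr addr0.
move/eqP; rewrite paddr_eq0 ?sqr_ge0 // !sqrf_eq0 !subr_eq0.
by case/andP => /eqP-> /eqP->.
Qed.

(** For [e = 1] the rotation by [angle R N c], for [e = -1] a reflection: in angles,
    the map u |-> c + e * u. *)
Definition isometry (R : realType) (N : nat) (e c : int) (x : R * R) : R * R :=
  (x.1 * cos (angle R N c) - e%:~R * x.2 * sin (angle R N c),
   x.1 * sin (angle R N c) + e%:~R * x.2 * cos (angle R N c)).

Lemma isometry_polar (R : realType) (N : nat) (e c : int) (rho : R) (u : int) :
  e = 1 \/ e = -1 ->
  isometry N e c (polar N rho u) = polar N rho (c + e * u).
Proof.
rewrite /isometry /polar /= angleD cosD sinD.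
case=> ->; rewrite ?mulN1r ?mul1r ?angleN ?cosN ?sinN ?rmorphN ?rmorph1.
  by congr pair; ring.
by congr pair; ring.
Qed.

Lemma dot_isometry (R : realType) (N : nat) (e c : int) (x y : R * R) :
  e = 1 \/ e = -1 ->
  dot (isometry N e c x) (isometry N e c y) = dot x y.
Proof.
move=> e_sign; have e2 : e%:~R ^+ 2 = 1 :> R.
  by case: e_sign => ->; rewrite ?rmorphN rmorph1 ?sqrrN expr1n.
have := cos2Dsin2 (angle R N c).
rewrite /dot /isometry /=; set C := cos _; set S := sin _ => CS.
transitivity ((C ^+ 2 + S ^+ 2) * (x.1 * y.1 + e%:~R ^+ 2 * (x.2 * y.2))); first ring.
by rewrite CS e2 !mul1r.
Qed.

Lemma isometry_inj (R : realType) (N : nat) (e c : int) :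
  e = 1 \/ e = -1 -> injective (@isometry R N e c).
Proof.
move=> e_sign x y eq_xy; apply: dot_eq; rewrite -[LHS](dot_isometry N c _ _ e_sign);
  by rewrite -[RHS](dot_isometry N c _ _ e_sign) eq_xy.
Qed.

Lemma C1_xi_parity (p : nat) (i j : 'I_p) :
  exists k : int, i%:Z - j%:Z = 2 * k + (C1_xi i j)%:Z.
Proof.
rewrite /C1_xi; have := odd_double_half i; have := odd_double_half j.
rewrite -!muln2; case: (odd i); case: (odd j) => /= j_eq i_eq.
- by exists (i./2%:Z - j./2%:Z); lia.
- by exists (i./2%:Z - j./2%:Z); lia.
- by exists (i./2%:Z - j./2%:Z - 1); lia.
- by exists (i./2%:Z - j./2%:Z); lia.
Qed.

Lemma C1_xi_le1 (p : nat) (i j : 'I_p) : (C1_xi i j <= 1)%N.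
Proof. by rewrite /C1_xi leq_b1. Qed.

Section Polygons.
Variables (R : realType) (t p : nat) (r : 'I_p -> R).
Let N := C1_N t p.
Hypothesis N_gt1 : (1 < N)%N.
Hypothesis r_gt0 : forall i, 0 < r i.
Hypothesis r_inj : injective r.
Let N_gt0 : (0 < N)%N := ltnW N_gt1.

(** The definition of the fiber lets [k] run over 1, ..., N; by periodicity it may
    run over all integers, which makes rotations and reflections easy to apply. *)
Lemma C1_fiberP (i : 'I_p) (x : R * R) :
  reflect (exists k : int, x = polar N (r i) (2 * k + i.+1%:Z)) (x \in C1_fiber t r i).
Proof.
have C1_ptE (k : nat) : C1_pt t r i k = polar N (r i) (2 * k%:Z + i.+1%:Z).
  by rewrite /C1_pt /polar /angle -PoszM -PoszD -pmulrn.
apply: (iffP (imfsetP _ _ _ _)) => /= [[k _ ->]|[k ->]].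
  by exists k%:Z; rewrite C1_ptE.
pose m := ((k - 1) %% N%:Z)%Z.
have m_ge0 : 0 <= m by apply: modz_ge0; lia.
have m_lt : m < N%:Z by apply: ltz_pmod; lia.
pose q := ((k - 1) %/ N%:Z)%Z.
exists (absz m).+1; first by rewrite mem_iota -/N; lia.
rewrite C1_ptE -[RHS](polar_turn _ _ q N_gt0); congr polar.
have := divz_eq (k - 1) N%:Z; rewrite -/m -/q => eq_k.
have -> : (absz m).+1%:Z = m + 1 by lia.
by transitivity (2 * (k - 1) + 2 + i.+1%:Z); [ring|rewrite eq_k; ring].
Qed.

Lemma C1_cosine_polar (i j : 'I_p) (u v : int) :
  C1_cosine r i j (polar N (r i) u) (polar N (r j) v) = cos (angle R N (u - v)).
Proof.
by rewrite /C1_cosine dot_polar mulrC mulKf // mulf_neq0 // gt_eqF.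
Qed.

(** The cosines occurring between two fibers are those of the folded angles in
    [0, N] of the same parity as [C1_xi]; discarding the value 1 discards the
    angle 0, so that the remaining angles are 2 * m + 2 - xi. *)
Lemma C1_sE (i j : 'I_p) : C1_s t r i j = (N + C1_xi i j)./2.
Proof.
rewrite /C1_s; set xi := C1_xi i j.
have xi_parity := C1_xi_parity i j; have xi_le1 : (xi <= 1)%N := C1_xi_le1 i j.
pose f (m : nat) := cos (angle R N (2 * m + 2 - xi)%N%:Z).
pose s := [seq f m | m <- iota 0 (N + xi)./2].
have f_inj : {in iota 0 (N + xi)./2 &, injective f}.
  move=> m m'; rewrite !mem_iota => m_lt m'_lt.
  by move/cos_angle_inj => /(_ N_gt0); lia.
suff -> : ([fset C1_cosine r i j x y | x in C1_fiber t r i, y in C1_fiber t r j] `\ 1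
    = seq_fset tt s)%fset.
  by rewrite size_seq_fset undup_id ?map_inj_in_uniq ?iota_uniq // size_map size_iota.
apply/fsetP => c; rewrite !inE seq_fsetE.
apply/andP/mapP => [[c_neq1 /imfset2P[x /C1_fiberP[k ->] [y /C1_fiberP[k' ->] eq_c]]]|].
  rewrite C1_cosine_polar in eq_c.
  have [d [z [le_d u_eq]]] := fold_angle (2 * k + i.+1%:Z - (2 * k' + j.+1%:Z)) N_gt0.
  have {}eq_c : c = cos (angle R N d).
    by case: u_eq eq_c => ->; rewrite cos_angle_turn ?angleN ?cosN.
  have d_neq0 : d != 0%N.
    by apply: contraNneq c_neq1 => d0; rewrite eq_c d0 /angle !mul0r cos0.
  case: xi_parity => h ij_eq.
  have [m d_eq] : exists m : nat, d = (2 * m + 2 - xi)%N.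
    exists ((d + xi) %/ 2 - 1)%N; case: u_eq; lia.
  by exists m; [rewrite mem_iota; lia|rewrite /f -d_eq].
case=> m; rewrite mem_iota => m_lt ->.
have le_d : (2 * m + 2 - xi <= N)%N by lia.
split.
  apply/eqP => f1; have : cos (angle R N (2 * m + 2 - xi)%N) = cos (angle R N 0%N).
    by rewrite -/(f m) f1 /angle !mul0r cos0.
  by move/cos_angle_inj => /(_ N_gt0 le_d isT); lia.
case: xi_parity => h ij_eq; apply/imfset2P => /=.
exists (polar N (r i) (2 * 0 + i.+1%:Z)); first by apply/C1_fiberP; exists 0.
exists (polar N (r j) (2 * (h + xi%:Z - m%:Z - 1) + j.+1%:Z)); first by apply/C1_fiberP; eexists.
rewrite C1_cosine_polar /f; congr (cos (angle R N _)); lia.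
Qed.

(** The folded angle that defines the relation [l]. *)
Definition C1_step (i j : 'I_p) (l : nat) : nat := (2 * (l - eps i j) + C1_xi i j)%N.

Lemma in_range_C1 (i j : 'I_p) (l : nat) :
  in_range (C := C1 t r) i j l = (eps i j <= l)%N && (C1_step i j l <= N)%N.
Proof.
rewrite /in_range /= /C1_rank C1_sE /C1_step /C1_xi /eps.
have [<-|neq_ij] /= := eqVneq i j; first by rewrite eqxx /=; lia.
by case: (odd i == odd j) => /=; lia.
Qed.

Lemma C1_rel_polar (i j : 'I_p) (l : nat) (u v : int) :
  C1_rel t r i j l (polar N (r i) u) (polar N (r j) v) =
  (cos (angle R N (u - v)) == cos (angle R N (C1_step i j l))).
Proof. by rewrite /C1_rel C1_cosine_polar -/N /angle -pmulrn. Qed.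

Lemma C1_step_inj (i j : 'I_p) (l l' : nat) :
  in_range (C := C1 t r) i j l -> in_range (C := C1 t r) i j l' ->
  cos (angle R N (C1_step i j l)) = cos (angle R N (C1_step i j l')) -> l = l'.
Proof.
rewrite !in_range_C1 => /andP[le_l le_lN] /andP[le_l' le_l'N].
by move/(cos_angle_inj N_gt0 le_lN le_l'N); rewrite /C1_step; lia.
Qed.

Lemma C1_partitioned : rel_partitioned (C1 t r).
Proof.
move=> i j _ _ /C1_fiberP[k ->] /C1_fiberP[k' ->].
set u := 2 * k + _; set v := 2 * k' + _.
have [d [z [le_d uv_eq]]] := fold_angle (u - v) N_gt0.
have [h ij_eq] := C1_xi_parity i j; have xi_le1 := C1_xi_le1 i j.
pose l := ((d - C1_xi i j)./2 + eps i j)%N.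
have l_step : C1_step i j l = d.
  rewrite /C1_step /l addnK; case: uv_eq; rewrite /u /v; lia.
have cos_uv : cos (angle R N (u - v)) = cos (angle R N (C1_step i j l)).
  by rewrite l_step; case: uv_eq => ->; rewrite cos_angle_turn ?angleN ?cosN.
have l_range : in_range (C := C1 t r) i j l.
  by rewrite in_range_C1 l_step le_d leq_addl.
exists l; split=> [|l' [l'_range]]; first by rewrite /= C1_rel_polar cos_uv.
rewrite /= C1_rel_polar cos_uv => /eqP; exact: C1_step_inj.
Qed.

(** Isometries preserve cosines, hence relations; the hypothesis on parities makes
    them preserve each polygon. *)
Lemma symmetry_isometry (e k : int) : e = 1 \/ e = -1 ->
  (forall i : 'I_p, exists h : int, i.+1%:Z * e + k = 2 * h + i.+1%:Z) ->
  symmetry (C := C1 t r) (isometry N e k).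
Proof.
move=> e_sign parity; split.
- exact: isometry_inj.
- move=> j _ /C1_fiberP[h ->]; rewrite isometry_polar //; apply/C1_fiberP.
  have [m m_eq] := parity j; exists (e * h + m); congr polar.
  by transitivity (2 * (e * h) + (2 * m + j.+1%:Z)); [rewrite -m_eq; ring|ring].
- by move=> i j l x y _ _; rewrite /= /C1_rel /C1_cosine dot_isometry.
Qed.

(** Two pairs in one relation have equal or opposite angle differences modulo
    [2 * N]; a rotation deals with the first case, a reflection with the second. *)
Lemma C1_transitive : rel_transitive (C1 t r).
Proof.
move=> i j l _ _ _ _ _ /C1_fiberP[k ->] /C1_fiberP[m ->] /C1_fiberP[k' ->] /C1_fiberP[m' ->].
rewrite /= !C1_rel_polar => /eqP <- /eqP /(cos_angle_eq N_gt0) [z uv_eq].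
have [e [e_sign {}uv_eq]] : exists e : int, (e = 1 \/ e = -1) /\
    2 * k' + i.+1%:Z - (2 * m' + j.+1%:Z) =
    e * (2 * k + i.+1%:Z - (2 * m + j.+1%:Z)) + 2 * N%:Z * z.
  by case: uv_eq => ->; [exists 1; rewrite mul1r; split; auto|
    exists (-1); rewrite mulN1r; split; auto].
pose c := 2 * k' + i.+1%:Z - e * (2 * k + i.+1%:Z).
exists (isometry N e c); rewrite !isometry_polar //; split.
- apply: symmetry_isometry => // h.
  case: e_sign => e_eq; rewrite /c e_eq.
    by exists (k' - k); ring.
  by exists (k' + k + i.+1%:Z - h.+1%:Z); ring.
- by congr polar; rewrite /c; ring.
- rewrite -(polar_turn _ _ (- z) N_gt0); congr polar.
  transitivity (2 * k' + i.+1%:Z - (e * (2 * k + i.+1%:Z - (2 * m + j.+1%:Z)) + 2 * N%:Z * z)).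
    by rewrite /c; ring.
  by rewrite -uv_eq; ring.
Qed.

Lemma coherent_C1 : coherent (C1 t r).
Proof.
have mem_polar i k : polar N (r i) (2 * k + i.+1%:Z) \in C1_fiber t r i.
  by apply/C1_fiberP; exists k.
split.
- by move=> i; apply/fset0Pn; exists (polar N (r i) (2 * 0 + i.+1%:Z)).
- move=> i j neq_ij; apply/fdisjointP => _ /C1_fiberP[k ->].
  apply: contra neq_ij => /C1_fiberP[k' eq_kk'].
  have := congr1 (fun x => dot x x) eq_kk'.
  rewrite !dot_polar !subrr /angle !mul0r cos0 !mulr1 -!expr2 => /eqP.
  by rewrite eqrXn2 ?ltW // => /eqP/r_inj->.
- move=> i j l _.
  have [h ij_eq] := C1_xi_parity i j.
  have [a step_eq] : exists a, C1_step i j l = (2 * a + C1_xi i j)%N.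
    by exists (l - eps i j)%N.
  exists (polar N (r i) (2 * (a%:Z - h) + i.+1%:Z)), (polar N (r j) (2 * 0 + j.+1%:Z)).
  split=> //=.
  by rewrite C1_rel_polar step_eq; apply/eqP; congr (cos (angle R N _)); lia.
- exact: C1_partitioned.
- move=> i _ _ /C1_fiberP[k ->] /C1_fiberP[k' ->].
  rewrite /= C1_rel_polar /C1_step /C1_xi /eps !eqxx /=.
  apply/eqP/eqP => [/(cos_angle_eq N_gt0)[z uv_eq]|eq_uv].
    apply/esym; rewrite -(polar_turn _ _ z N_gt0); congr polar.
    by case: uv_eq; lia.
  have := congr1 (fun x => dot x (polar N (r i) (2 * k' + i.+1%:Z))) eq_uv.
  by rewrite !dot_polar subrr => /mulfI; apply; rewrite mulf_neq0 // gt_eqF.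
- move=> i j l x y _ _ _.
  by rewrite /= /C1_rel /C1_cosine dotC [r j * _]mulrC /eps /C1_xi [i == j]eq_sym [odd i == _]eq_sym.
exact: intersection_numbers_of_transitive C1_partitioned C1_transitive.
Qed.

(** Moving by two units along the first polygon changes the folded angle to the second
    one by at most two units, hence its relation by at most one. *)
Lemma cross_B1_tridiagonal_C1 : cross_B1_tridiagonal (C1 t r).
Proof.
apply: cross_B1_tridiagonal_of; first exact: coherent_C1.
move=> i j l l' _ _ _ _ /C1_fiberP[k ->] /C1_fiberP[k' ->] /C1_fiberP[m ->].
rewrite !in_range_C1 => /andP[le_l le_lN] /andP[le_l' le_l'N].
rewrite /= !C1_rel_polar => /eqP/(cos_angle_eq N_gt0)[z1 eq1].
move=> /eqP/(cos_angle_eq N_gt0)[z2 eq2] /eqP/(cos_angle_eq N_gt0)[z3 eq3].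
have step1 : C1_step i i 1 = 2%N by rewrite /C1_step /eps /C1_xi !eqxx.
rewrite step1 in eq1.
suff : (C1_step i j l' <= C1_step i j l + 2)%N.
  by rewrite /C1_step; lia.
set d := C1_step i j l in le_lN eq2 *; set d' := C1_step i j l' in le_l'N eq3 *.
have [a [z [a_sign d'_eq]]] : exists a z : int, (a = 2 \/ a = -2) /\
    (d'%:Z = a + d%:Z + 2 * (N%:Z * z) \/ d'%:Z = a - d%:Z + 2 * (N%:Z * z)).
  have [a [a_sign {}eq1]] : exists a : int, (a = 2 \/ a = -2) /\
      2 * k + i.+1%:Z - (2 * k' + i.+1%:Z) = a + 2 * N%:Z * z1.
    by case: eq1 => ->; [exists 2|exists (-2)]; split; auto.
  case: eq3 => eq3; [exists a, (z1 + z2 - z3)|exists (- a), (z3 - z1 - z2)];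
    (split; first lia).
    by case: eq2 => eq2; [left|right]; lia.
  by case: eq2 => eq2; [right|left]; lia.
(* A nonzero number of turns moves by at least [2 * N], so that both folded angles
   lie within 2 of the end point [N]. *)
have N_z : z = 0 \/ N%:Z <= N%:Z * z \/ N%:Z * z <= - N%:Z by nia.
by case: N_z d'_eq => [->|]; rewrite ?mulr0; lia.
Qed.

End Polygons.

Theorem proposition5p9 :
  (forall (R : realType) (t p : nat) (r : 'I_p -> R),
     (0 < t)%N -> (1 <= p)%N -> (p <= (t + 5) %/ 4)%N ->
     (forall i : 'I_p, 0 < r i) ->
     (forall i j : 'I_p, (i < j)%N -> r i < r j) ->
     coherent (C1 t r) /\ cross_B1_tridiagonal (C1 t r)) /\
  (forall n : nat, (0 < n)%N ->
     coherent (C2 n) /\ cross_B1_tridiagonal (C2 n)) /\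
  (forall (F : finFieldType) (n : nat), (0 < n)%N ->
     coherent (C3 F n) /\ cross_B1_tridiagonal (C3 F n)).
Proof.
split; [|split].
- move=> R t p r t_gt0 p_gt0 le_p r_gt0 r_incr.
  have N_gt1 : (1 < C1_N t p)%N by rewrite /C1_N; lia.
  have r_inj : injective r.
    move=> i j eq_r; apply/val_inj/eqP; rewrite eqn_leq.
    apply/andP; split; rewrite leqNgt; apply/negP => /r_incr;
      by rewrite eq_r ltxx.
  split; first exact: coherent_C1.
  exact: cross_B1_tridiagonal_C1.
- move=> n _; have geom := meet_geometry_C2 n.
  split; first exact: coherent_meet_geometry geom.
  exact: tridiagonal_meet_geometry geom.
- move=> F n _; have geom := meet_geometry_C3 F n.
  split; first exact: coherent_meet_geometry geom.
  exact: tridiagonal_meet_geometry geom.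
Qed.
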